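(* Let $n$ be a positive integer. Consider all simple jump paths in dimension $2$ from $(n+1,n+1)$ to $(0,0)$, and the multiset of gap sums of all gap vectors occurring in all of these paths (each path contributing one gap vector per step). For an integer $v\ge 0$, let $P_n(v)$ be the number of gap sums equal to $v$ in this multiset divided by the total number of gap vectors in this multiset. Then $P_n(0)=P_n(1)=0$, and for every fixed integer $v\ge 2$, \[\lim_{n\to\infty} P_n(v) \;=\; \frac{v-1}{2^{v}}.\]
   Context: A simple jump path in dimension $2$ of length $k$ starting at $(a_1,a_2)$ (with $a_1,a_2$ positive integers) is a sequence of lattice points $(x_{0,1},x_{0,2}),\dots,(x_{k,1},x_{k,2})$ in $\mathbb{Z}_{\ge 0}^2$ with $(x_{0,1},x_{0,2})=(a_1,a_2)$, $(x_{k,1},x_{k,2})=(0,0)$, and $x_{i,j}>x_{i+1,j}$ for all $i\in\{0,\dots,k-1\}$ and $j\in\{1,2\}$. Each step from $(x_{i,1},x_{i,2})$ to $(x_{i+1,1},x_{i+1,2})$ has gap vector $(x_{i,1}-x_{i+1,1},\,x_{i,2}-x_{i+1,2})$, and the gap sum of that step is the sum of the two components of its gap vector. A path of length $k$ has $k$ gap vectors (including the final step into the origin). *)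

(* Defs.v *)
From HB Require Import structures.
From mathcomp Require Import all_boot all_order all_algebra finmap.
From mathcomp Require Import all_classical all_reals all_analysis.
Import Order.TTheory GRing.Theory Num.Theory.
Import numFieldNormedType.Exports.

Set Implicit Arguments.
Unset Strict Implicit.
Unset Printing Implicit Defensive.

Local Open Scope classical_set_scope.
Local Open Scope nat_scope.

Definition lattice_point : Type := (nat * nat)%type.

Definition origin : lattice_point := (0, 0).

Definition jump : rel lattice_point := [rel x y : lattice_point | (y.1 < x.1) && (y.2 < x.2)].

(* The sequence x lists all k.+1 points, including the start a and the end
   (0, 0); the default value of nth is irrelevant because of the size
   constraint. *)
Definition simple_jump_path (k : nat) (a : lattice_point) (x : seq lattice_point) : bool :=
  [&& size x == k.+1, nth origin x 0 == a, nth origin x k == origin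
    & sorted jump x].

Definition simple_jump_paths (a : lattice_point) : set (seq lattice_point) :=
  [set x | exists k, simple_jump_path k a x].

(* Truncated subtraction is exact along a jump. *)
Definition gap (x y : lattice_point) : lattice_point := (x.1 - y.1, x.2 - y.2).

Definition gap_vectors (x : seq lattice_point) : seq lattice_point :=
  [seq gap z.1 z.2 | z <- zip x (behead x)].

Definition gap_sums (x : seq lattice_point) : seq nat :=
  [seq g.1 + g.2 | g <- gap_vectors x].

Lemma size_gap_vectors k a x :
  simple_jump_path k a x -> size (gap_vectors x) = k.
Proof.
by case/andP => /eqP sx _; rewrite size_map size_zip size_behead sx; apply/minn_idPr.
Qed.

Lemma path_jump_bounded a x : path jump a x ->
  (size x <= a.1) && all (fun y : lattice_point => (y.1 <= a.1) && (y.2 <= a.2)) x.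
Proof.
elim: x a => [//|y x IH] a /= /andP[/andP[h1 h2] /IH /andP[hs /allP hx]].
rewrite (leq_ltn_trans hs h1) (ltnW h1) (ltnW h2) /=.
apply/allP => z /hx /andP[z1 z2].
by rewrite (leq_trans z1 (ltnW h1)) (leq_trans z2 (ltnW h2)).
Qed.

Lemma finite_simple_jump_paths a : finite_set (simple_jump_paths a).
Proof.
pose T := ('I_a.1.+1 * 'I_a.2.+1)%type.
pose f (t : T) : lattice_point := (val t.1, val t.2).
pose g (u : {n : 'I_a.1.+2 & n.-tuple T}) := [seq f t | t <- tagged u].
apply: (@sub_finite_set _ _ (g @` setT)); last exact/finite_image/finite_finset.
move=> x [k /and4P[/eqP sx /eqP xa _ xp]].
case: x sx xa xp => [//|b x] /= sx ba; rewrite {b}ba => xp.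
have /andP[hs hx] := path_jump_bounded xp.
pose h (y : lattice_point) : T := (inord y.1, inord y.2).
have hsz : size (map h (a :: x)) < a.1.+2 by rewrite size_map.
exists (Tagged (fun n : 'I_a.1.+2 => n.-tuple T) (i := Ordinal hsz)
  (in_tuple (map h (a :: x)))) => //.
rewrite /g /= /in_tuple /= -map_comp; congr cons.
  by rewrite /f /= !inordK // -surjective_pairing.
rewrite -[RHS]map_id; apply/eq_in_map => y /(allP hx) /andP[y1 y2].
by rewrite /f /= !inordK // -surjective_pairing.
Qed.

(* A sequence representing the multiset (its order is irrelevant).  fset_set
   would yield the empty set on an infinite set; here it enumerates all paths
   by finite_simple_jump_paths. *)
Definition gap_sum_multiset (n : nat) : seq nat :=
  flatten [seq gap_sums x | x <- fset_set (simple_jump_paths (n.+1, n.+1))].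

Lemma gap_sum_multiset_gt0 n : 0 < size (gap_sum_multiset n).
Proof.
have h : [:: (n.+1, n.+1); origin] \in fset_set (simple_jump_paths (n.+1, n.+1)).
  rewrite in_fset_set; last exact: finite_simple_jump_paths.
  by rewrite inE; exists 1; rewrite /simple_jump_path /= !eqxx.
rewrite lt0n; apply/negP => /eqP/size0nil h0.
have : (n.+1 + n.+1) \in gap_sum_multiset n.
  apply/flattenP; exists (gap_sums [:: (n.+1, n.+1); origin]).
    exact: map_f.
  by rewrite inE /= !subn0.
by rewrite h0.
Qed.

Definition gap_sum_freq (R : realType) (n v : nat) : R :=
  ((count_mem v (gap_sum_multiset n))%:R / (size (gap_sum_multiset n))%:R)%R.

(* Main.v *)
Require Import Defs.
From HB Require Import structures.
From mathcomp Require Import all_boot all_order all_algebra finmap.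
From mathcomp Require Import all_classical all_reals all_analysis.
From mathcomp Require Import zify ring.
Import Order.TTheory GRing.Theory Num.Theory.
Import numFieldNormedType.Exports.

(* A path of length k from (n+1, n+1) is a pair of compositions of n+1 into k
   parts, so there are C(n, k-1)^2 of them and the number of gap vectors is the
   sum over j of (j+1) C(n, j)^2.  The gap (a, b) occurs k times as often in
   paths of length k as there are paths of length k-1 from (n+1-a, n+1-b), that
   is, for a, b <= n, the sum over j of (j+2) C(n-a, j) C(n-b, j) times in all.
   By Vandermonde, the sum over j of (j+c) C(m, j) C(p, j) equals
   C(m+p, m) (c + mp / (m+p)); the quotient of the two counts therefore tends to
   2^-(a+b), and v = a + b has v - 1 decompositions into positive parts. *)

Local Open Scope classical_set_scope.
Local Open Scope nat_scope.

(** * Enumeration of the paths by length *)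

Definition box (p : lattice_point) : seq lattice_point :=
  [seq (i, j) | i <- index_iota 0 p.1, j <- index_iota 0 p.2].

Fixpoint jump_paths (k : nat) (p : lattice_point) : seq (seq lattice_point) :=
  if k is k'.+1 then [seq p :: x | q <- box p, x <- jump_paths k' q]
  else if p == origin then [:: [:: origin]] else [::].

Lemma mem_box p q : (q \in box p) = jump p q.
Proof.
case: q => i j.
apply/allpairsP/andP => [[[i' j'] [/= hi hj [-> ->]]]|[/= hi hj]].
  by move: hi hj; rewrite !mem_index_iota.
by exists (i, j); rewrite /= !mem_index_iota.
Qed.

Lemma uniq_box p : uniq (box p).
Proof. by apply: allpairs_uniq; rewrite ?iota_uniq // => -[? ?] [? ?]. Qed.

Lemma big_box (f : lattice_point -> nat) p :
  \sum_(q <- box p) f q = \sum_(0 <= i < p.1) \sum_(0 <= j < p.2) f (i, j).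
Proof. by rewrite big_allpairs. Qed.

(** The default head [origin] is harmless: for empty [x] both sides fail the size condition. *)
Lemma simple_jump_path_cons k p p' x :
  simple_jump_path k.+1 p (p' :: x) =
  [&& p' == p, jump p (head origin x) & simple_jump_path k (head origin x) x].
Proof.
rewrite /simple_jump_path /= eqSS.
case: x => [|q x] /=; first by rewrite !andbF.
rewrite eqxx /=; case: (p' =P p) => [->|_]; last by rewrite !andbF.
by rewrite /= [RHS]andbCA; congr andb; rewrite andbCA.
Qed.

Lemma mem_jump_paths k p x : (x \in jump_paths k p) = simple_jump_path k p x.
Proof.
elim: k p x => [|k IH] p x.
  rewrite /simple_jump_path /=; case: x => [|q [|r x]] /=.
  - by case: ifP.
  - rewrite andbT (fun_if (fun s => [:: q] \in s)) !inE eqseq_cons eqxx andbT.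
    case: (p =P origin) => [->|/eqP hp]; first by rewrite andbb.
    by case: (q =P p) => // ->; rewrite (negbTE hp).
  - by case: ifP => //; rewrite inE eqseq_cons andbF.
apply/allpairsPdep/idP => [[q [y [hq hy ->]]]|].
  rewrite mem_box in hq; rewrite IH in hy.
  rewrite simple_jump_path_cons eqxx.
  have -> : head origin y = q by case/and4P: hy => _ /eqP <- _ _; case: (y).
  by rewrite hq hy.
case: x => [|p' x]; first by rewrite /simple_jump_path.
rewrite simple_jump_path_cons => /and3P[/eqP-> h1 h2].
by exists (head origin x), x; rewrite mem_box IH.
Qed.

Lemma head_jump_paths {k p x} : x \in jump_paths k p -> x = p :: behead x.
Proof.
by rewrite mem_jump_paths => /and4P[/eqP + /eqP + _ _]; case: x => // q x _ /= ->.
Qed.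

Lemma uniq_jump_paths k p : uniq (jump_paths k p).
Proof.
elim: k p => [|k IH] p /=; first by case: ifP.
apply: allpairs_uniq_dep => // [|u w]; first exact: uniq_box.
case/allpairsPdep => [q [x [_ hx ->]]] /allpairsPdep[r [y [_ hy ->]]] /= [exy].
by move: hx; rewrite exy => /head_jump_paths; rewrite (head_jump_paths hy) => -[->].
Qed.

(** The first coordinate drops at every jump, so no length exceeds [p.1]; the lists for different
    [k] are disjoint because the number of points determines [k]. *)
Lemma perm_simple_jump_paths p :
  perm_eq (fset_set (simple_jump_paths p))
          [seq x | k <- index_iota 0 p.1.+1, x <- jump_paths k p].
Proof.
apply: uniq_perm; first exact: fset_uniq.
  apply: allpairs_uniq_dep => [|k _|u w]; [exact: iota_uniq|exact: uniq_jump_paths|].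
  case/allpairsPdep => [k [x [_ hx ->]]] /allpairsPdep[l [y [_ hy ->]]] /= exy.
  move: hx hy; rewrite exy !mem_jump_paths => /andP[/eqP h _] /andP[/eqP + _].
  by rewrite h => -[->].
move=> x; rewrite in_fset_set; last exact: finite_simple_jump_paths.
apply/idP/allpairsPdep; rewrite inE; last first.
  by move=> [k [y [_ + ->]]]; rewrite mem_jump_paths => hy; exists k.
move=> [k hk]; exists k, x; split; rewrite ?mem_jump_paths //.
rewrite mem_index_iota ltnS /=.
case/and4P: hk => /eqP; case: x => // q x [<-] /eqP /= -> _ xp.
by have /andP[] := path_jump_bounded xp.
Qed.

Lemma big_simple_jump_paths (f : seq lattice_point -> nat) p :
  \sum_(x <- fset_set (simple_jump_paths p)) f x =
  \sum_(0 <= k < p.1.+1) \sum_(x <- jump_paths k p) f x.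
Proof.
by rewrite (perm_big _ (perm_simple_jump_paths p)) big_allpairs_dep.
Qed.

(** * Compositions and the number of paths *)

(** The number of compositions of [i] into [k] positive parts; [j] is what remains once the first
    part is removed. *)
Fixpoint ncomp (k i : nat) : nat :=
  if k is k'.+1 then \sum_(0 <= j < i) ncomp k' j else i == 0.

Lemma ncompS k i : ncomp k.+1 i.+1 = 'C(i, k).
Proof.
elim: k i => [|k IH] i.
  by rewrite /= bin0 big_nat_recl //= big1.
rewrite -[LHS]/(\sum_(0 <= j < i.+1) ncomp k.+1 j) big_nat_recl //.
rewrite -[ncomp k.+1 0]/(\sum_(0 <= j < 0) ncomp k j) big_geq // add0n.
under eq_bigr do rewrite IH.
(* What is left is the hockey-stick identity. *)
by elim: i => [|i IHi]; [rewrite big_geq | rewrite big_nat_recr //= IHi].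
Qed.

(* The truncated difference i - a would wrongly count compositions of 0 when
   i < a. *)
Definition ncomp_sub (k a i : nat) : nat :=
  if a <= i then ncomp k (i - a) else 0.

Lemma sum_ncomp_gap k a i : 0 < a ->
  \sum_(0 <= j < i) (i - j == a) * ncomp k j = ncomp_sub k a i.
Proof.
move=> a0; rewrite /ncomp_sub big_mkord; case: leqP => hai.
  have h : i - a < i by lia.
  rewrite (bigD1 (Ordinal h)) //= subKn // eqxx mul1n big1 ?addn0 // => j.
  rewrite -val_eqE /= => hj; case: eqP => //; have := ltn_ord j; lia.
by rewrite big1 // => j _; case: eqP => //; have := ltn_ord j; lia.
Qed.

(** The recursion of [ncomp], shifted by [a]; it serves the paths whose marked gap is not the first
    one. *)
Lemma sum_ncomp_sub k a i :
  \sum_(0 <= j < i) ncomp_sub k a j = ncomp_sub k.+1 a i.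
Proof.
rewrite /ncomp_sub; case: (leqP a i) => hai /=.
  rewrite (big_cat_nat (n := a)) //= big_nat_cond big1 ?add0n; last first.
    by move=> j /andP[/andP[_ hj] _]; rewrite leqNgt hj.
  rewrite -{1}[a]add0n big_addn; apply: eq_bigr => j _.
  by rewrite leq_addl addnK.
rewrite big_nat_cond big1 // => j /andP[/andP[_ hj] _].
by rewrite leqNgt (ltn_trans hj hai).
Qed.

(** The box of possible next points is a product, so the two coordinates evolve independently. *)
Lemma size_jump_paths k p : size (jump_paths k p) = ncomp k p.1 * ncomp k p.2.
Proof.
elim: k p => [|k IH] p /=.
  by case: p => [[|i] [|j]].
rewrite size_allpairs_dep sumnE big_map big_box.
under eq_bigr do under eq_bigr do rewrite IH /=.
by under eq_bigr do rewrite -big_distrr /=; rewrite -big_distrl.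
Qed.

(** * Counting gap vectors and gap sums *)

Lemma gap_vectors_cons p q x :
  gap_vectors [:: p, q & x] = gap p q :: gap_vectors (q :: x).
Proof. by []. Qed.

(* Deleting one of the k gaps, when it equals (a, b), leaves a path of length
   k.-1 from p - (a, b); hence the factor k. *)
Lemma sum_count_gap_vectors k p a b : 0 < a -> 0 < b ->
  \sum_(x <- jump_paths k p) count_mem (a, b) (gap_vectors x) =
  k * (ncomp_sub k.-1 a p.1 * ncomp_sub k.-1 b p.2).
Proof.
move=> a0 b0; elim: k p => [|k IH] p /=.
  by rewrite big1_seq // => x /andP[_]; case: ifP => //; rewrite inE => _ /eqP ->.
rewrite big_allpairs_dep /=.
(* Split by the first jump, from [p] to [q]: the first summand counts that jump's own gap, the
   second the later gaps, by induction. *)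
transitivity (\sum_(q <- box p)
   ((p.1 - q.1 == a) * (p.2 - q.2 == b) * (ncomp k q.1 * ncomp k q.2) +
    k * (ncomp_sub k.-1 a q.1 * ncomp_sub k.-1 b q.2))).
  apply: eq_bigr => q _; rewrite -IH -size_jump_paths -sum1_size big_distrr -big_split /=.
  apply: eq_big_seq => x /head_jump_paths ->.
  by rewrite gap_vectors_cons /= muln1 /gap xpair_eqE mulnb.
rewrite big_split /= !big_box /= mulSn; congr addn.
  rewrite -!sum_ncomp_gap // big_distrl /=; apply: eq_bigr => i _.
  by rewrite big_distrr /=; apply: eq_bigr => j _; rewrite mulnACA.
(* Later gaps: there are none for [k = 0]; otherwise the shifted recursion applies in each
   coordinate. *)
case: k {IH} => [|k]; first by rewrite mul0n big1 // => i _; rewrite big1.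
rewrite /= -!sum_ncomp_sub big_distrl big_distrr /=; apply: eq_bigr => i _.
by rewrite big_distrr big_distrr.
Qed.

Lemma gap_vectors_gt0 k p x g : x \in jump_paths k p -> g \in gap_vectors x ->
  (0 < g.1) && (0 < g.2).
Proof.
elim: k p x => [|k IH] p x /=; first by case: ifP => // _; rewrite inE => /eqP ->.
case/allpairsPdep => q [y [hq hy ->]]; rewrite (head_jump_paths hy) gap_vectors_cons.
rewrite inE -(head_jump_paths hy) => /orP[/eqP ->|]; last exact: IH hy.
by move: hq; rewrite mem_box /= !subn_gt0.
Qed.

(** Both components of a gap are positive, so the first runs from 1 to [v - 1]; for [v <= 1] nothing
    is left. *)
Lemma count_gap_sums {k p x} v : x \in jump_paths k p ->
  count_mem v (gap_sums x) =
  \sum_(1 <= a < v) count_mem (a, v - a) (gap_vectors x).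
Proof.
move=> hx; rewrite /gap_sums count_map.
have : all (fun g => (0 < g.1) && (0 < g.2)) (gap_vectors x).
  by apply/allP => g; apply: gap_vectors_gt0 hx.
elim: (gap_vectors x) => [|[c d] s IH] /=; first by rewrite big1.
case/andP => /andP[c0 d0] /IH ->; rewrite big_split /=; congr addn.
case: (c + d =P v) => [<-|h].
  rewrite (bigD1_seq c) ?iota_uniq //=; last by rewrite mem_index_iota; lia.
  rewrite addKn eqxx big1 // => a ha; rewrite xpair_eqE eq_sym (negbTE ha) //.
rewrite big_nat_cond big1 // => a; rewrite xpair_eqE => ha.
by case: eqP => //= hc; case: eqP => // hd; lia.
Qed.

Lemma count_gap_sum_multiset n v : v <= n ->
  count_mem v (gap_sum_multiset n) =
  \sum_(1 <= a < v) \sum_(0 <= j < n)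
    (j + 2) * ('C(n - a, j) * 'C(n - (v - a), j)).
Proof.
move=> vn; rewrite /gap_sum_multiset count_flatten sumnE !big_map big_simple_jump_paths /=.
transitivity (\sum_(0 <= k < n.+2) \sum_(1 <= a < v)
   k * (ncomp_sub k.-1 a n.+1 * ncomp_sub k.-1 (v - a) n.+1)).
  apply: eq_bigr => k _.
  rewrite (eq_big_seq _ (fun x hx => count_gap_sums v hx)).
  rewrite exchange_big /= big_nat_cond [RHS]big_nat_cond; apply: eq_bigr => a.
  by rewrite andbT => ha; rewrite sum_count_gap_vectors //; lia.
rewrite exchange_big /= big_nat_cond [RHS]big_nat_cond; apply: eq_bigr => a.
(* The terms [k = 0] and [k = 1] vanish: a single jump has gap [(n.+1, n.+1)], while [a <= n]. Hence
   [k = j + 2] from here on. *)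
rewrite andbT => ha; rewrite big_nat_recl // mul0n add0n big_nat_recl //.
rewrite {1}/ncomp_sub /= ifT; last by lia.
have -> : (n.+1 - a == 0) = false by lia.
rewrite mul0n muln0 add0n; apply: eq_bigr => j _.
rewrite /ncomp_sub !ifT; try lia.
have [-> ->] : n.+1 - a = (n - a).+1 /\ n.+1 - (v - a) = (n - (v - a)).+1 by lia.
by rewrite !ncompS addn2.
Qed.

Lemma size_gap_sum_multiset n :
  size (gap_sum_multiset n) = \sum_(0 <= j < n.+1) (j + 1) * ('C(n, j) * 'C(n, j)).
Proof.
rewrite /gap_sum_multiset size_flatten sumnE !big_map big_simple_jump_paths /=.
rewrite big_nat_recl // big1_seq ?add0n; last first.
  by move=> x; rewrite inE.
apply: eq_bigr => j _; rewrite -!ncompS addn1.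
rewrite -(size_jump_paths j.+1 (n.+1, n.+1)) -sum1_size big_distrr; apply: eq_big_seq => x.
by rewrite mem_jump_paths size_map => /size_gap_vectors ->; rewrite /= muln1.
Qed.

(** * Vandermonde sums *)

(** The shift [d] makes the induction on [m] work: Pascal's rule on the first binomial produces one
    sum with shift [d] and one with [d.+1]. *)
Lemma sum_bin_bin m p d N : m < N ->
  \sum_(0 <= j < N) 'C(m, j) * 'C(p, j + d) = 'C(m + p, m + d).
Proof.
elim: m d N => [|m IH] d [|N] // mN; rewrite big_nat_recl // mul1n add0n.
  by rewrite big1 ?addn0 // => j _; rewrite bin0n.
under eq_bigr do rewrite binS mulnDl addSnnS.
rewrite big_split /= addnA IH // addnS binS addnC; congr addn.
rewrite -(IH d N.+1); last exact: ltnW.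
by rewrite big_nat_recl // bin0 mul1n; under [in RHS]eq_bigr do rewrite addSnnS.
Qed.

(** The factor [j] is absorbed by [j C(m, j) = m C(m-1, j-1)], Vandermonde with shift 1 sums the
    result, and [(m+p) C(m+p-1, m) = p C(m+p, m)] finishes. The factor [m + p] avoids division. *)
Lemma sum_mul_bin_bin m p c N : m < N ->
  (m + p) * \sum_(0 <= j < N) (j + c) * ('C(m, j) * 'C(p, j)) =
  (m * p + c * (m + p)) * 'C(m + p, m).
Proof.
move=> mN; under eq_bigr do rewrite mulnDl.
rewrite big_split /= -big_distrr /=.
have := @sum_bin_bin m p 0 N mN; under eq_bigr do rewrite addn0; rewrite addn0 => ->.
rewrite [LHS]mulnDr [RHS]mulnDl; congr addn; last by rewrite mulnCA mulnA.
case: N mN => // N mN; rewrite big_nat_recl // mul0n add0n.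
case: m mN => [|m] mN.
  by rewrite big1 ?muln0 // => j _; rewrite bin0n muln0.
under eq_bigr => j _ do rewrite mulnA -mul_bin_diag -mulnA -[j.+1]addn1 /=.
rewrite -big_distrr /= sum_bin_bin // mulnCA -mulnA; congr muln.
rewrite addn1 -[m + p]/((m.+1 + p).-1) mul_bin_down.
by rewrite addKn.
Qed.

(** * Limits *)

Local Open Scope ring_scope.

Lemma cvg_affine_ratio (R : realType) (a b c d : R) : b != 0 ->
  (a * n%:R + c) / (b * n%:R + d) @[n --> \oo] --> a / b.
Proof.
move=> b0.
have h (x y : R) : x + (y - x) * n.+1%:R^-1 @[n --> \oo] --> x.
  rewrite -[X in _ --> X]addr0 -[X in _ --> _ + X](mulr0 (y - x)).
  by apply: cvgD; [exact: cvg_cst | apply: cvgM; [exact: cvg_cst | exact: cvg_harmonic]].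
(* Factoring out [n.+1], which is never zero, reduces the claim to the harmonic sequence. *)
have e (x y : R) n : x * n%:R + y = n.+1%:R * (x + (y - x) * n.+1%:R^-1).
  by rewrite -natr1; field; rewrite natr1 pnatr_eq0.
have -> : (fun n : nat => (a * n%:R + c) / (b * n%:R + d)) =
          (fun n => (a + (c - a) * n.+1%:R^-1) / (b + (d - b) * n.+1%:R^-1)).
  by apply/funext => n; rewrite !e -mulf_div divff ?mul1r // pnatr_eq0.
by apply: cvgM; [exact: h | apply: cvgV => //; exact: h].
Qed.

(** Raising [a] by one multiplies the binomial by a ratio tending to 2; the symmetry of binomials
    gives the same for [b]. *)
Lemma cvg_bin_ratio (R : realType) (a b : nat) :
  'C(n + a + (n + b), n + a)%:R / 'C(n + n, n)%:R @[n --> \oo] --> (2 ^+ (a + b) : R).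
Proof.
have B0 m p : 'C(m + p, m)%:R != 0 :> R by rewrite pnatr_eq0 -lt0n bin_gt0 leq_addr.
have sym m p : 'C(m + p, m) = 'C(p + m, p) by rewrite -bin_sub ?leq_addr // addKn addnC.
have step m p : 'C(m.+1 + p, m.+1)%:R = (m.+1 + p)%:R / m.+1%:R * 'C(m + p, m)%:R :> R.
  have m0 : m.+1%:R != 0 :> R by rewrite pnatr_eq0.
  apply: (mulfI m0); rewrite mulrA mulrCA mulfV // mulr1 -!natrM.
  by rewrite -(mul_bin_diag (m.+1 + p) m).
have lim c d : (n + c.+1 + (n + d))%:R / (n + c.+1)%:R @[n --> \oo] --> (2 : R).
  have := @cvg_affine_ratio R 2 1 (c.+1 + d)%:R c.+1%:R (oner_neq0 _).
  rewrite divr1; apply: cvg_trans; apply: near_eq_cvg; apply: nearW => n.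
  by congr (_ / _); rewrite !natrD; ring.
elim: a => [|a IHa].
  elim: b => [|b IHb].
    rewrite (_ : (fun n => _) = (fun=> 1)); first exact: cvg_cst.
    by apply/funext => n; rewrite !addn0 divff.
  rewrite add0n exprS (_ : (fun n => _) = (fun n =>
    (n + b.+1 + (n + 0))%:R / (n + b.+1)%:R * ('C(n + 0 + (n + b), n + 0)%:R / 'C(n + n, n)%:R))).
    by apply: cvgM; [exact: lim | exact: IHb].
  by apply/funext => n; rewrite mulrA sym addnS step -sym.
rewrite addSn exprS (_ : (fun n => _) = (fun n =>
  (n + a.+1 + (n + b))%:R / (n + a.+1)%:R * ('C(n + a + (n + b), n + a)%:R / 'C(n + n, n)%:R))).
  by apply: cvgM; [exact: lim | exact: IHa].
by apply/funext => n; rewrite mulrA addnS step.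
Qed.

(** After division by [n.+1], the term [mp / (m+p)] tends to 1/2 and [c] disappears. The condition
    [0 < a + b] keeps [m + p] nonzero even at [n = 0]. *)
Lemma cvg_sum_bin_ratio (R : realType) (a b c : nat) (N : nat -> nat) :
  (0 < a + b)%N -> (forall n, n + a < N n)%N ->
  (\sum_(0 <= j < N n) (j + c) * ('C(n + a, j) * 'C(n + b, j)))%N%:R /
    (n.+1%:R * 'C(n + n, n)%:R) @[n --> \oo] --> (2 ^+ (a + b) / 2 : R).
Proof.
move=> ab0 hN.
have e n : (\sum_(0 <= j < N n) (j + c) * ('C(n + a, j) * 'C(n + b, j)))%N%:R =
   ((n + a)%:R * ((n + b)%:R / (n + a + (n + b))%:R) + c%:R) *
     'C(n + a + (n + b), n + a)%:R :> R.
  have h0 : (n + a + (n + b))%:R != 0 :> R by rewrite pnatr_eq0; lia.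
  apply: (mulfI h0); rewrite -natrM sum_mul_bin_bin // natrM natrD !natrM.
  move: (_ + _ + _)%:R h0 => D h0; field; exact: h0.
rewrite (_ : (fun n => _) = (fun n =>
  'C(n + a + (n + b), n + a)%:R / 'C(n + n, n)%:R *
  ((1 * n%:R + a%:R) / (1 * n%:R + 1) * ((1 * n%:R + b%:R) / (2 * n%:R + (a + b)%:R))
   + (0 * n%:R + c%:R) / (1 * n%:R + 1)))); last first.
  apply/funext => n; rewrite e -natr1.
  have -> : (n + a + (n + b))%:R = 2 * n%:R + (a + b)%:R :> R by rewrite !natrD; ring.
  rewrite invfM !mul1r mul0r add0r !natrD; ring.
apply: cvgM; first exact: cvg_bin_ratio.
have -> : (2^-1 : R) = 1 / 1 * (1 / 2) + 0 / 1 by rewrite mul0r addr0 !mul1r invr1 mul1r.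
by apply: cvgD; [apply: cvgM|]; apply: cvg_affine_ratio; rewrite ?oner_neq0 ?pnatr_eq0.
Qed.

Theorem theorem1p4 (R : realType) :
  (forall n : nat, (0 < n)%N -> gap_sum_freq R n 0 = 0 /\ gap_sum_freq R n 1 = 0) /\
  (forall v : nat, (2 <= v)%N ->
     gap_sum_freq R n v @[n --> \oo] --> ((v%:R - 1) / 2 ^+ v : R)).
Proof.
split=> [n n0|v v2].
  by rewrite /gap_sum_freq !count_gap_sum_multiset // !big_geq // mul0r.
(* With [n + v] in place of [n], the upper indices become [n + (v - a)] and [n + a], free of
   truncation. *)
rewrite -(cvg_shiftn v) /=.
pose D (n : nat) : R := n.+1%:R * 'C(n + n, n)%:R.
have D0 n : D n != 0 by rewrite mulf_neq0 // pnatr_eq0 // -lt0n bin_gt0 leq_addr.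
pose S (a b c N n : nat) : R :=
  (\sum_(0 <= j < N) (j + c) * ('C(n + a, j) * 'C(n + b, j)))%N%:R / D n.
rewrite (_ : (fun n => _) = (fun n =>
  (\sum_(1 <= a < v) S (v - a)%N a 2 (n + v) n) / S v v 1 (n + v).+1 n)); last first.
  apply/funext => n; rewrite /gap_sum_freq size_gap_sum_multiset.
  rewrite count_gap_sum_multiset ?leq_addl // /S -mulr_suml.
  rewrite invf_div mulrA divfK // natr_sum; congr (_ / _).
  rewrite big_nat_cond [RHS]big_nat_cond; apply: eq_bigr => a.
  rewrite andbT => ha; congr (_%:R); apply: eq_bigr => j _.
  by congr (_ * ('C(_, _) * 'C(_, _)))%N; lia.
(* The offsets add up to [v] in each numerator term and to [v + v] in the denominator. *)
have -> : (v%:R - 1) / 2 ^+ v = (\sum_(1 <= a < v) 2 ^+ v / 2) / (2 ^+ (v + v) / 2) :> R.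
  rewrite sumr_const_nat exprD -[X in _ = X / _]mulr_natl natrB; last exact: ltnW.
  by field; rewrite expf_neq0.
apply: cvgM; last first.
  apply: cvgV; first by rewrite mulf_neq0 ?expf_neq0.
  by apply: cvg_sum_bin_ratio => [|n]; lia.
rewrite big_nat_cond.
under eq_cvg do rewrite big_nat_cond.
apply: cvg_big => [|a]; first exact: add_continuous.
rewrite andbT => ha.
rewrite -[X in _ ^+ X](@subnK a v); last lia.
by apply: cvg_sum_bin_ratio => [|n]; lia.
Qed.
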